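(* For all positive integers $n$ and $r$, $$\sum_{k=0}^{n}\frac{r}{k+r}\binom{n}{k}=\sum_{j=0}^{r-1}(-1)^{r-1-j}\,r\binom{r-1}{j}\left(\frac{2^{n+j+1}-1}{n+j+1}\right).$$
   Context: Here $\binom{n}{k}$ is the usual binomial coefficient; the identity is between rational numbers. The paper denotes the left-hand side by $S(n,r)$. *)

(* Defs.v *)
From mathcomp Require Export all_boot all_order all_algebra.

(* Main.v *)
Require Import Defs.
From mathcomp Require Import all_boot all_order all_algebra.
From mathcomp Require Import ring.
Import GRing.Theory Num.Theory.
Local Open Scope ring_scope.

(** With [r = m + 1] and after division by [r], the two sides are the integral
    of [x^m (1 + x)^n] over [0, 1] and, substituting [y = 1 + x], that of
    [(y - 1)^m y^n] over [1, 2].  Both satisfy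
    [I(n, m + 1) = I(n + 1, m) - I(n, m)], by Pascal's rule, so induction on [m]
    reduces the identity to [m = 0]. *)

Lemma sum_binS (V : zmodType) (f : nat -> V) (n : nat) :
  \sum_(0 <= k < n.+2) f k *+ 'C(n.+1, k) =
  \sum_(0 <= k < n.+1) (f k + f k.+1) *+ 'C(n, k).
Proof.
rewrite big_nat_recl // bin0.
under eq_bigr => k _ do rewrite binS mulrnDr.
rewrite big_split /= big_nat_recr //= bin_small // mulr0n addr0 addrA.
under [RHS]eq_bigr => k _ do rewrite mulrnDl.
by rewrite big_split /= [in RHS]big_nat_recl // bin0.
Qed.

(** Absorption, [(k + 1) 'C(n+1, k+1) = (n + 1) 'C(n, k)], turns each summand into
    ['C(n+1, k+1) / (n + 1)]; these numerators are the expansion of [(1 + 1)^(n+1)] without its term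
    [k = 0]. *)
Lemma sum_bin_divS (n : nat) :
  \sum_(0 <= k < n.+1) (k.+1%:R^-1 *+ 'C(n, k)) =
  (2%:R ^+ n.+1 - 1) / n.+1%:R :> rat.
Proof.
have nz (m : nat) : m.+1%:R != 0 :> rat by rewrite pnatr_eq0.
have -> : 2%:R ^+ n.+1 = \sum_(0 <= k < n.+2) 'C(n.+1, k)%:R :> rat.
  rewrite -[2%:R]/(1 + 1) exprDn big_mkord.
  by apply: eq_bigr => k _; rewrite !expr1n mulr1.
rewrite [in RHS]big_nat_recl // bin0 [_ - 1]addrC addKr mulr_suml.
apply: eq_bigr => k _; apply: (canRL (mulfK (nz n))).
rewrite -[X in X * _]mulr_natr -mulrA -natrM mulnC mul_bin_diag natrM mulrA.
by rewrite mulVf // mul1r.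
Qed.

Lemma sum_bin_div (n m : nat) :
  \sum_(0 <= k < n.+1) ((k + m).+1%:R^-1 *+ 'C(n, k)) =
  \sum_(0 <= j < m.+1)
     ((-1) ^+ (m - j) * ((2%:R ^+ (n + j).+1 - 1) / (n + j).+1%:R))
        *+ 'C(m, j) :> rat.
Proof.
elim: m n => [|m IHm] n.
  rewrite big_nat1 expr0 mul1r bin0 addn0 -sum_bin_divS.
  by under eq_bigr => k _ do rewrite addn0.
(* This rewrites the right-hand side, with its ['C(m.+1, j)]; on the left, Pascal's rule is applied
   next in [n] instead. *)
rewrite sum_binS.
have -> : \sum_(0 <= k < n.+1) ((k + m.+1).+1%:R^-1 *+ 'C(n, k)) =
    \sum_(0 <= k < n.+2) ((k + m).+1%:R^-1 *+ 'C(n.+1, k)) -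
    \sum_(0 <= k < n.+1) ((k + m).+1%:R^-1 *+ 'C(n, k)) :> rat.
  rewrite sum_binS -sumrB; apply: eq_bigr => k _.
  by rewrite -mulrnBl addrC addKr addnS addSn.
(* The bound [j <= m] is kept because subtraction is truncated: it gives [m.+1 - j = (m - j).+1],
   hence the sign change. *)
rewrite !IHm -sumrB; apply: eq_big_nat => j /andP[_ ltjm].
rewrite -mulrnBl subSS subSn // (exprS (-1)) mulN1r addnS addSn.
by congr (_ *+ _); rewrite mulNr addrC.
Qed.

Theorem lemma1 (n r : nat) (hn : (0 < n)%N) (hr : (0 < r)%N) :
  \sum_(0 <= k < n.+1) (r%:R / (k + r)%:R * ('C(n, k))%:R) =
  \sum_(0 <= j < r)
     ((-1) ^+ (r - 1 - j) * r%:R * ('C(r - 1, j))%:R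
        * ((2%:R ^+ (n + j + 1) - 1) / (n + j + 1)%:R)) :> rat.
Proof.
case: r hr => // m _; rewrite subn1 /=.
transitivity (m.+1%:R *
    \sum_(0 <= k < n.+1) ((k + m).+1%:R^-1 *+ 'C(n, k)) : rat).
  rewrite mulr_sumr; apply: eq_bigr => k _.
  by rewrite addnS -[X in _ = _ * X]mulr_natr mulrA.
rewrite sum_bin_div mulr_sumr; apply: eq_bigr => j _.
rewrite addn1 -[X in _ * X = _]mulr_natr.
set a := (-1) ^+ _; set b := _ / _; ring.
Qed.
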